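(* For every information set $\Gamma\subseteq L$ and every $\alpha\in L$: $\Gamma\vdash_{\mathbf{GBD}}\alpha$ if and only if $\Gamma\vDash_{\mathbf{GBD}}\alpha$.
   Context: Let $\mathbf{PL}$ be classical propositional logic with language $L_{\mathbf{PL}}$ generated from a (possibly countably infinite) set of propositional atoms with the usual connectives, where $\bot$ and $\top$ are a canonical contradiction and a canonical tautology. $\vdash_{\mathbf{PL}}$ is classical deduction, $V$ is the set of classical valuations, and $M(\phi)\subseteq V$ is the set of models of $\phi\in L_{\mathbf{PL}}$. $\mathcal{P}X$ denotes the powerset of $X$. Language: $L=L_B\cup L_D$, where $L_B=L_{\mathbf{PL}}$ (potential beliefs) and $L_D=\{\overline{\phi}\mid\phi\in L_{\mathbf{PL}}\}$ (potential disbeliefs). Here $\overline{\phi}$ is a new formal expression, one for each $\phi\in L_{\mathbf{PL}}$; the bar is not a connective, so it is not nested or combined with connectives. An information set is any $\Gamma\subseteq L$; put $\Gamma_B=\Gamma\cap L_B$, $\Gamma_D=\Gamma\cap L_D$, and $\overline{\Gamma}_D=\{\lnot\phi\mid\overline{\phi}\in\Gamma_D\}\subseteq L_{\mathbf{PL}}$. Deduction: $\vdash_{\mathbf{GBD}}$ is the smallest binary relation $\vdash$ from $\mathcal{P}L$ to $L$ closed under the following rules (for all $\Gamma\subseteq L$, $\phi\in L_B$): (B) if $\Gamma_B\vdash_{\mathbf{PL}}\phi$ then $\Gamma\vdash\phi$; (D$\bot$) if $\phi\vdash_{\mathbf{PL}}\bot$ then $\Gamma\vdash\overline{\phi}$;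 (GD) if $\overline{\Gamma}_D\vdash_{\mathbf{PL}}\lnot\phi$ then $\Gamma\vdash\overline{\phi}$. Semantics: a $\mathbf{GBD}$-model is an ordered pair $\mathcal{M}=(M,N)$ with $M,N\subseteq V$. For $\phi\in L_B$, $\mathcal{M}\Vdash\phi$ iff $M\subseteq M(\phi)$. For $\overline{\phi}\in L_D$, $\mathcal{M}\Vdash\overline{\phi}$ iff $N\subseteq M(\lnot\phi)$. $\mathcal{M}\Vdash\Gamma$ iff $\mathcal{M}\Vdash\alpha$ for all $\alpha\in\Gamma$. $\Gamma\vDash_{\mathbf{GBD}}\alpha$ iff $\mathcal{M}\Vdash\alpha$ for every $\mathbf{GBD}$-model $\mathcal{M}$ with $\mathcal{M}\Vdash\Gamma$. *)

(* Defs.v *)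
From mathcomp Require Import all_boot.
From mathcomp Require Import classical_sets.

Set Implicit Arguments.
Unset Strict Implicit.
Unset Printing Implicit Defensive.

Local Open Scope classical_set_scope.

Inductive form (A : Type) : Type :=
| Atom of A
| Bot
| Top
| Neg of form A
| And of form A & form A
| Or of form A & form A
| Imp of form A & form A
| Iff of form A & form A.

Arguments Bot {A}.
Arguments Top {A}.

(* Classical natural deduction.  The set of premises may be infinite, but
   derivations are finite trees, so only finitely many premises are used. *)
Inductive pl_ded (A : Type) : set (form A) -> form A -> Prop :=
| pl_ax (G : set (form A)) p : G p -> pl_ded G p
| pl_topI (G : set (form A)) : pl_ded G Top
| pl_botE (G : set (form A)) p : pl_ded G Bot -> pl_ded G p
| pl_raa (G : set (form A)) p : pl_ded (G `|` [set Neg p]) Bot -> pl_ded G p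
| pl_negI (G : set (form A)) p : pl_ded (G `|` [set p]) Bot -> pl_ded G (Neg p)
| pl_negE (G : set (form A)) p : pl_ded G (Neg p) -> pl_ded G p -> pl_ded G Bot
| pl_andI (G : set (form A)) p q :
    pl_ded G p -> pl_ded G q -> pl_ded G (And p q)
| pl_andE1 (G : set (form A)) p q : pl_ded G (And p q) -> pl_ded G p
| pl_andE2 (G : set (form A)) p q : pl_ded G (And p q) -> pl_ded G q
| pl_orI1 (G : set (form A)) p q : pl_ded G p -> pl_ded G (Or p q)
| pl_orI2 (G : set (form A)) p q : pl_ded G q -> pl_ded G (Or p q)
| pl_orE (G : set (form A)) p q r :
    pl_ded G (Or p q) -> pl_ded (G `|` [set p]) r ->
    pl_ded (G `|` [set q]) r -> pl_ded G r
| pl_impI (G : set (form A)) p q :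
    pl_ded (G `|` [set p]) q -> pl_ded G (Imp p q)
| pl_impE (G : set (form A)) p q :
    pl_ded G (Imp p q) -> pl_ded G p -> pl_ded G q
| pl_iffI (G : set (form A)) p q :
    pl_ded (G `|` [set p]) q -> pl_ded (G `|` [set q]) p -> pl_ded G (Iff p q)
| pl_iffE1 (G : set (form A)) p q :
    pl_ded G (Iff p q) -> pl_ded G p -> pl_ded G q
| pl_iffE2 (G : set (form A)) p q :
    pl_ded G (Iff p q) -> pl_ded G q -> pl_ded G p.

Definition valuation (A : Type) : Type := A -> bool.

Fixpoint eval (A : Type) (v : valuation A) (p : form A) : bool :=
  match p with
  | Atom a => v a
  | Bot => false
  | Top => true
  | Neg p => ~~ eval v p
  | And p q => eval v p && eval v q
  | Or p q => eval v p || eval v q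
  | Imp p q => eval v p ==> eval v q
  | Iff p q => eval v p == eval v q
  end.

Definition models (A : Type) (p : form A) : set (valuation A) :=
  [set v | eval v p].

(* [Bel p] is the formula p viewed as an element of L_B, and [Dis p] is the
   formal expression \overline{p} of L_D; L is their disjoint union. *)
Inductive expr (A : Type) : Type :=
| Bel of form A
| Dis of form A.

Definition beliefs (A : Type) (G : set (expr A)) : set (form A) :=
  [set p | G (Bel p)].

(* The set \overline{G}_D of negations of the disbelieved formulas. *)
Definition neg_disbeliefs (A : Type) (G : set (expr A)) : set (form A) :=
  [set Neg p | p in [set p | G (Dis p)]].

Inductive gbd_ded (A : Type) : set (expr A) -> expr A -> Prop :=
| gbd_B (G : set (expr A)) p : pl_ded (beliefs G) p -> gbd_ded G (Bel p)
| gbd_Dbot (G : set (expr A)) p : pl_ded [set p] Bot -> gbd_ded G (Dis p)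
| gbd_GD (G : set (expr A)) p :
    pl_ded (neg_disbeliefs G) (Neg p) -> gbd_ded G (Dis p).

Definition gbd_model (A : Type) : Type :=
  (set (valuation A) * set (valuation A))%type.

Definition gbd_sat (A : Type) (MN : gbd_model A) (a : expr A) : Prop :=
  match a with
  | Bel p => MN.1 `<=` models p
  | Dis p => MN.2 `<=` models (Neg p)
  end.

Definition gbd_sat_set (A : Type) (MN : gbd_model A) (G : set (expr A)) : Prop :=
  forall a, G a -> gbd_sat MN a.

Definition gbd_entails (A : Type) (G : set (expr A)) (a : expr A) : Prop :=
  forall MN : gbd_model A, gbd_sat_set MN G -> gbd_sat MN a.

(* Main.v *)
(** Rules (B) and (GD) reduce completeness to strong completeness of classical
    natural deduction: an underivable belief is refuted by the pair consisting
    of the set of all models of the beliefs and the empty set, and an underivable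
    disbelief by the pair of the empty set and the set of all models of the
    negated disbeliefs.  Propositional completeness is Lindenbaum's argument via
    Zorn's lemma: for a maximal consistent extension, derivability commutes with
    all connectives, hence is evaluation at a valuation. *)
Require Import Defs.
From mathcomp Require Import all_boot.
From mathcomp Require Import boolp classical_sets.

Set Implicit Arguments.
Unset Strict Implicit.
Unset Printing Implicit Defensive.

Local Open Scope classical_set_scope.

Lemma pl_weaken (A : Type) (G H : set (form A)) p :
  G `<=` H -> pl_ded G p -> pl_ded H p.
Proof.
move=> GH d; elim: d H GH => {G p}.
- by move=> G p Gp H GH; apply/pl_ax/GH.
- by move=> *; apply: pl_topI.
- by move=> G p _ IH H GH; apply/pl_botE/IH.
- by move=> G p _ IH H GH; apply/pl_raa/IH/setSU.
- by move=> G p _ IH H GH; apply/pl_negI/IH/setSU.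
- by move=> G p _ IHn _ IH H GH; apply: (pl_negE (IHn _ GH) (IH _ GH)).
- by move=> G p q _ IHp _ IHq H GH; apply: pl_andI; [apply: IHp|apply: IHq].
- by move=> G p q _ IH H GH; apply: pl_andE1 (IH _ GH).
- by move=> G p q _ IH H GH; apply: pl_andE2 (IH _ GH).
- by move=> G p q _ IH H GH; apply/pl_orI1/IH.
- by move=> G p q _ IH H GH; apply/pl_orI2/IH.
- move=> G p q r _ IH _ IHp _ IHq H GH.
  by apply: (pl_orE (IH _ GH)); [apply/IHp/setSU|apply/IHq/setSU].
- by move=> G p q _ IH H GH; apply/pl_impI/IH/setSU.
- by move=> G p q _ IH _ IHp H GH; apply: (pl_impE (IH _ GH) (IHp _ GH)).
- move=> G p q _ IHp _ IHq H GH.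
  by apply: pl_iffI; [apply/IHp/setSU|apply/IHq/setSU].
- by move=> G p q _ IH _ IHp H GH; apply: (pl_iffE1 (IH _ GH) (IHp _ GH)).
- by move=> G p q _ IH _ IHp H GH; apply: (pl_iffE2 (IH _ GH) (IHp _ GH)).
Qed.

(** The valuation stays fixed through the induction: a discharged hypothesis matters only when it is
    true at [v], and [ext] then adds it to the context. *)
Lemma pl_sound (A : Type) (G : set (form A)) p (v : valuation A) :
  pl_ded G p -> (forall q, G q -> eval v q) -> eval v p.
Proof.
have ext (H : set (form A)) q : (forall r, H r -> eval v r) -> eval v q ->
    forall r, (H `|` [set q]) r -> eval v r.
  by move=> vH vq r [/vH//|->].
elim=> {G p} //=.
- by move=> G p Gp vG; apply: vG.
- by move=> G p _ IH vG; have := IH vG.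
- by move=> G p _ IH vG; apply/negPn/negP => np; have := IH (ext _ (Neg p) vG np).
- by move=> G p _ IH vG; apply/negP => vp; have := IH (ext _ _ vG vp).
- by move=> G p _ IHn _ IH vG; have := IHn vG; rewrite IH.
- by move=> G p q _ IHp _ IHq vG; rewrite IHp // IHq.
- by move=> G p q _ IH /IH /andP[].
- by move=> G p q _ IH /IH /andP[].
- by move=> G p q _ IH vG; rewrite IH.
- by move=> G p q _ IH vG; rewrite IH ?orbT.
- move=> G p q r _ IH _ IHp _ IHq vG.
  by case/orP: (IH vG) => /(ext _ _ vG); [exact: IHp|exact: IHq].
- by move=> G p q _ IH vG; apply/implyP => /(ext _ _ vG)/IH.
- by move=> G p q _ IH _ IHp vG; apply: (implyP (IH vG)); apply: IHp.
- move=> G p q _ IHp _ IHq vG; apply/eqP; apply/idP/idP.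
    by move=> /(ext _ _ vG)/IHp.
  by move=> /(ext _ _ vG)/IHq.
- by move=> G p q _ IH _ IHp vG; rewrite -(eqP (IH vG)); apply: IHp.
- by move=> G p q _ IH _ IHp vG; rewrite (eqP (IH vG)); apply: IHp.
Qed.

(* The fixed part [E] absorbs the hypotheses discharged inside the derivation. *)
Lemma pl_ded_chain (A : Type) (F : set (set (form A))) (E : set (form A)) p :
  F !=set0 -> total_on F subset ->
  pl_ded (E `|` \bigcup_(X in F) X) p ->
  exists2 X, F X & pl_ded (E `|` X) p.
Proof.
move=> [X0 FX0] Ftot; move DE: (E `|` _) => D d; move: DE => /esym DE.
(* The context is an index that grows under discharge. An inclusion is an invariant of the
   induction: [ext] restores it after moving the discharged formula into [E]. *)
have {DE}: D `<=` E `|` \bigcup_(X in F) X by rewrite DE.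
have join1 (X Y E' : set (form A)) q : X `<=` Y -> pl_ded (E' `|` X) q -> pl_ded (E' `|` Y) q.
  by move=> XY; apply: pl_weaken; apply: setUS.
(* Rules with several premises may get a different member of the chain from each; totality puts them
   inside a single one. *)
have join X Y : F X -> F Y -> exists Z, [/\ F Z, X `<=` Z & Y `<=` Z].
  by move=> FX FY; case: (Ftot _ _ FX FY) => ?; [exists Y|exists X]; split.
have ext (G E' : set (form A)) q : G `<=` E' `|` \bigcup_(X in F) X ->
    G `|` [set q] `<=` (E' `|` [set q]) `|` \bigcup_(X in F) X.
  by move=> GE; rewrite setUAC; apply: setSU.
elim: d E => {D p}.
- move=> G p Gp E /(_ _ Gp)[Ep|[X FX Xp]].
    (* No member of the chain is singled out here, so any one serves; this is where [F] being
       nonempty enters. *)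
    by exists X0 => //; apply: pl_ax; left.
  by exists X => //; apply: pl_ax; right.
- by move=> G E _; exists X0 => //; apply: pl_topI.
- by move=> G p _ IH E /IH[X FX d]; exists X => //; apply: pl_botE.
- move=> G p _ IH E /ext/IH[X FX d]; exists X => //.
  by apply: pl_raa; rewrite setUAC.
- move=> G p _ IH E /ext/IH[X FX d]; exists X => //.
  by apply: pl_negI; rewrite setUAC.
- move=> G p _ IHn _ IH E GE.
  have [[X FX dX] [Y FY dY]] := (IHn _ GE, IH _ GE).
  have [Z [FZ XZ YZ]] := join _ _ FX FY; exists Z => //.
  exact: (pl_negE (join1 _ _ _ _ XZ dX) (join1 _ _ _ _ YZ dY)).
- move=> G p q _ IHn _ IH E GE.
  have [[X FX dX] [Y FY dY]] := (IHn _ GE, IH _ GE).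
  have [Z [FZ XZ YZ]] := join _ _ FX FY; exists Z => //.
  exact: (pl_andI (join1 _ _ _ _ XZ dX) (join1 _ _ _ _ YZ dY)).
- by move=> G p q _ IH E /IH[X FX d]; exists X => //; apply: pl_andE1 d.
- by move=> G p q _ IH E /IH[X FX d]; exists X => //; apply: pl_andE2 d.
- by move=> G p q _ IH E /IH[X FX d]; exists X => //; apply: pl_orI1.
- by move=> G p q _ IH E /IH[X FX d]; exists X => //; apply: pl_orI2.
- move=> G p q r _ IH _ IHp _ IHq E GE.
  have [[X FX dX] [Y FY dY]] := (IH _ GE, IHp _ (ext _ _ p GE)).
  have [W FW dW] := IHq _ (ext _ _ q GE).
  have [Z [FZ XZ YZ]] := join _ _ FX FY.
  have [T [FT ZT WT]] := join _ _ FZ FW; exists T => //.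
  apply: pl_orE (join1 _ _ _ _ (subset_trans XZ ZT) dX) _ _.
    by rewrite setUAC; apply: join1 _ dY; apply: subset_trans YZ ZT.
  by rewrite setUAC; apply: join1 _ dW.
- move=> G p q _ IH E /ext/IH[X FX d]; exists X => //.
  by apply: pl_impI; rewrite setUAC.
- move=> G p q _ IHn _ IH E GE.
  have [[X FX dX] [Y FY dY]] := (IHn _ GE, IH _ GE).
  have [Z [FZ XZ YZ]] := join _ _ FX FY; exists Z => //.
  exact: (pl_impE (join1 _ _ _ _ XZ dX) (join1 _ _ _ _ YZ dY)).
- move=> G p q _ IHp _ IHq E GE.
  have [[X FX dX] [Y FY dY]] := (IHp _ (ext _ _ p GE), IHq _ (ext _ _ q GE)).
  have [Z [FZ XZ YZ]] := join _ _ FX FY; exists Z => //.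
  apply: pl_iffI; rewrite setUAC; first exact: join1 XZ dX.
  exact: join1 YZ dY.
- move=> G p q _ IHn _ IH E GE.
  have [[X FX dX] [Y FY dY]] := (IHn _ GE, IH _ GE).
  have [Z [FZ XZ YZ]] := join _ _ FX FY; exists Z => //.
  exact: (pl_iffE1 (join1 _ _ _ _ XZ dX) (join1 _ _ _ _ YZ dY)).
- move=> G p q _ IHn _ IH E GE.
  have [[X FX dX] [Y FY dY]] := (IHn _ GE, IH _ GE).
  have [Z [FZ XZ YZ]] := join _ _ FX FY; exists Z => //.
  exact: (pl_iffE2 (join1 _ _ _ _ XZ dX) (join1 _ _ _ _ YZ dY)).
Qed.

(** Zorn is applied to the sets [X] with [G] joined to [X] consistent, rather than to supersets of
    [G]: the empty chain then has union [set0], admissible because [G] itself is consistent.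
    Nonempty chains are handled by finiteness of derivations, in the form of [pl_ded_chain]. *)
Lemma lindenbaum (A : Type) (G : set (form A)) :
  ~ pl_ded G Bot ->
  exists T, [/\ G `<=` T, ~ pl_ded T Bot &
                forall p, pl_ded (T `|` [set p]) Bot \/ T p].
Proof.
move=> Gcon.
have [|M [Mcon Mmax]] := @Zorn_bigcup _ [set X | ~ pl_ded (G `|` X) Bot].
  move=> F Fcon Ftot /=.
  have [->|/set0P F0] := eqVneq F set0; first by rewrite bigcup_set0 setU0.
  by case/(pl_ded_chain F0 Ftot) => X /Fcon.
exists (G `|` M); split=> // p.
have [Tp|Tp] := pselect ((G `|` M) p); first by right.
left; apply: contrapT => Tpcon.
have MMp : M `<` M `|` [set p].
  by split=> [q Mq|/(_ p (or_intror erefl)) Mp]; [left|apply: Tp; right].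
by apply: (Mmax _ MMp); rewrite /= setUA.
Qed.

Lemma pl_complete (A : Type) (G : set (form A)) p :
  (forall v : valuation A, (forall q, G q -> eval v q) -> eval v p) ->
  pl_ded G p.
Proof.
move=> Gp; apply: pl_raa; apply: contrapT => /lindenbaum[T [GT Tcon Tmax]].
have cut q r : pl_ded (T `|` [set q]) r -> pl_ded T q -> pl_ded T r.
  by move=> /pl_impI/pl_impE; apply.
(* Consistency of [T] gives one direction, maximality the other. *)
have dN q : pl_ded T (Neg q) <-> ~ pl_ded T q.
  split=> [dNq dq|ndq]; first exact/Tcon/(pl_negE dNq dq).
  by case: (Tmax q) => [/pl_negI//|/pl_ax].
(* Ex falso for underivable hypotheses; it settles the false-antecedent cases of the connectives
   below. *)
have bot q r : ~ pl_ded T q -> pl_ded (T `|` [set q]) r.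
  move=> /dN dNq; apply/pl_botE/(@pl_negE _ _ q); last by apply: pl_ax; right.
  by apply: pl_weaken dNq; left.
pose v : valuation A := fun a => `[< pl_ded T (Atom a) >].
(* Truth lemma: [v] reads derivability off atoms, and structural induction extends this to all
   formulas. *)
have evalE q : eval v q = `[< pl_ded T q >].
  elim: q => //=.
  - by apply/esym/asboolPn.
  - by apply/esym/asboolP/pl_topI.
  - by move=> q ->; rewrite -asbool_neg; apply/asbool_equiv_eq; rewrite dN.
  - move=> q -> r ->; rewrite -asbool_and; apply/asbool_equiv_eq.
    by split=> [[]|d]; [exact: pl_andI|split; [exact: pl_andE1 d|exact: pl_andE2 d]].
  - move=> q -> r ->; rewrite -asbool_or; apply/asbool_equiv_eq.
    split=> [[/pl_orI1|/pl_orI2]//|d].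
    (* Primeness of [T]: if [q] is underivable, both branches of the disjunction lead to [r]. *)
    have [|/bot dq] := pselect (pl_ded T q); first by left.
    by right; apply: (pl_orE d (dq r)); apply: pl_ax; right.
  - move=> q -> r ->; rewrite -asbool_imply; apply/asbool_equiv_eq.
    split=> [qr|/pl_impE//]; apply: pl_impI.
    have [/qr|/bot//] := pselect (pl_ded T q).
    by apply: pl_weaken; left.
  - move=> q -> r ->; apply/idP/asboolP => [/eqP e|d].
      have [qr rq] := asbool_eq_equiv e; apply: pl_iffI.
        have [/qr|/bot//] := pselect (pl_ded T q).
        by apply: pl_weaken; left.
      have [/rq|/bot//] := pselect (pl_ded T r).
      by apply: pl_weaken; left.
    by apply/eqP/asbool_equiv_eq; split; [exact: pl_iffE1|exact: pl_iffE2].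
(* [T] contains both [G] and [Neg p], so [v] would make [p] true by assumption and false by the
   truth lemma. *)
have : eval v p.
  by apply: Gp => q Gq; rewrite evalE; apply/asboolP/pl_ax/GT; left.
have : eval v (Neg p) by rewrite evalE; apply/asboolP/pl_ax/GT; right.
by move=> /= /negP.
Qed.

Theorem theorem2 (A : countType) (Gamma : set (expr A)) (alpha : expr A) :
  gbd_ded Gamma alpha <-> gbd_entails Gamma alpha.
Proof.
split=> [[{}Gamma p d|{}Gamma p d|{}Gamma p d] [M N] sat /= v Xv|].
- by apply: (pl_sound d) => q Gq; exact: (sat (Bel q)).
(* Rule (D$\bot$): [p] is false at every valuation, whatever [N] is. *)
- by apply/negP => vp; have : eval v Bot by apply: (pl_sound d) => q ->.
- by apply: (pl_sound d) => _ [q Gq <-]; exact: (sat (Dis q)).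
case: alpha => p ent.
  apply/gbd_B/pl_complete => v vG.
  (* The empty second component satisfies all disbeliefs vacuously, and [v] lies in the first by
     [vG]. *)
  apply: (ent ([set w | forall q, beliefs Gamma q -> eval w q], set0)) => //.
  by case=> q Gq //= w; apply.
apply/gbd_GD/pl_complete => v vG.
apply: (ent (set0, [set w | forall q, neg_disbeliefs Gamma q -> eval w q])) => //.
by case=> q Gq //= w; apply; exists q.
Qed.
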